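(* Let $p\ge 2$ and $m\ge 1$ be integers, $\tau>0$, $\mu>0$, and $\alpha>1$ with $\alpha m/p$ an integer. Let $X_1,\dots,X_p$ be i.i.d. exponential random variables with rate $\mu$ (the initial delays of the $p$ workers). Let $T_{\text{LT}}$ and $T_{\text{ideal}}$ be the latencies, for the same realization of $X_1,\dots,X_p$, of the rateless (LT) coded strategy with redundancy $\alpha$ and of the ideal load balancing strategy, respectively. Then $$\Pr(T_{\text{LT}} > T_{\text{ideal}}) \le p\exp\left(-\frac{\mu\tau m(\alpha-1)}{p^2}\right).$$
   Context: Setting: a matrix with $m$ rows is multiplied by a vector using $p$ workers. Delay model: worker $i$ has a random initial delay $X_i$, after which it performs row-vector product tasks one after the other, each taking time $\tau$; so it needs time $X_i+\tau b$ to complete $b$ tasks. Thus a worker that never runs out of tasks has completed $N_i(t)=\max(0,\lfloor (t-X_i)/\tau\rfloor)$ tasks by time $t$. Ideal load balancing: the $m$ tasks are kept in a central queue and each worker is given a new task as soon as it becomes available; the latency is the time at which $m$ tasks have been completed in total, i.e. $T_{\text{ideal}}=\min\{t:\sum_{i=1}^p N_i(t)\ge m\}$. Rateless (LT) coded strategy with redundancy $\alpha$: $m_e=\alpha m$ encoded rows are generated and divided equally among the $p$ workers, so each worker can complete at most $\alpha m/p$ tasks and is idle after that. The result can be decoded once the workers have collectively completed $M'$ tasks, where the decoding threshold $M'$ is taken to be equal to $m$. Hence $T_{\text{LT}}=\min\{t:\sum_{i=1}^p \min(\alpha m/p,\,N_i(t))\ge m\}$. *)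

(* Defs.v *)
From mathcomp Require Import all_boot all_order all_algebra.
From mathcomp Require Import all_classical all_reals all_analysis.
Set Implicit Arguments.
Unset Strict Implicit.
Unset Printing Implicit Defensive.
Import Order.TTheory GRing.Theory Num.Theory.
Import numFieldNormedType.Exports.
Local Open Scope classical_set_scope.
Local Open Scope ring_scope.

Definition mutually_independent (d : measure_display) (T : measurableType d)
    (R : realType) (P : probability T R) (I : finType)
    (X : I -> {RV P >-> R}) : Prop :=
  forall (J : {set I}) (A : I -> set R), (forall i, measurable (A i)) ->
    P (\bigcap_(i in [set` J]) (X i @^-1` A i)) =
    (\prod_(i in J) P (X i @^-1` A i))%E.

(* Only Borel sets are tested: [exponential_prob rate] is a function on all
   sets, with no meaning on the others. *)
Definition exponentially_distributed (d : measure_display)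
    (T : measurableType d) (R : realType) (P : probability T R) (rate : R)
    (X : {RV P >-> R}) : Prop :=
  forall A : set R, measurable A ->
    distribution P X A = exponential_prob rate A.

Section Latency.
Variable R : realType.

Definition is_min (A : set R) (t : R) : Prop := A t /\ lbound A t.

(* The junk value 0 is returned only when [A] has no minimum. *)
Definition minimum (A : set R) : R := xget 0 [set t | is_min A t].

(* Tasks completed by time t by a worker with initial delay x and time tau per
   task, when it never runs out of tasks. *)
Definition completed (tau x t : R) : int :=
  Num.max 0 (Num.floor ((t - x) / tau)).

(* In both latencies t ranges over all of R. For 0 < tau, 1 <= m, 0 < p (and
   1 <= alpha for the second) both sets do have a minimum, for every x: they
   are nonempty, upward closed, bounded below since [completed] vanishes for
   small t, and contain their infimum since [completed] is right-continuous
   in t. *)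
Definition T_ideal (p m : nat) (tau : R) (x : 'I_p -> R) : R :=
  minimum [set t | m%:Z <= \sum_(i < p) completed tau (x i) t].

(* The alpha * m encoded rows are split equally among the p workers; decoding
   succeeds as soon as m products are available. *)
Definition T_LT (p m : nat) (alpha tau : R) (x : 'I_p -> R) : R :=
  minimum [set t | m%:R <= \sum_(i < p)
    Num.min (alpha * m%:R / p%:R) (completed tau (x i) t)%:~R].

End Latency.

(* Main.v *)
(* Put c = alpha m / p and b = ceil (m / p), and let t be the ideal latency.  If
   the LT latency exceeds t, some worker i would have completed more than c
   tasks by time t, so X_i + (c + 1) tau <= t; and since t is minimal, not all
   workers have X_j + b tau < t, for otherwise p b >= m tasks would have been
   completed earlier.  Hence X_j - X_i >= (c + 1 - b) tau
   > u := tau m (alpha - 1) / p^2, so some delay lies outside [0, u], which has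
   probability exp (- mu u) for each worker; conclude by the union bound. *)
Require Import Defs.
From mathcomp Require Import all_boot all_order all_algebra.
From mathcomp Require Import all_classical all_reals all_analysis.
From mathcomp Require Import measurable_realfun.
From mathcomp Require Import lra zify.
Set Implicit Arguments.
Unset Strict Implicit.
Unset Printing Implicit Defensive.
Import Order.TTheory GRing.Theory Num.Theory.
Import numFieldNormedType.Exports.
Local Open Scope classical_set_scope.
Local Open Scope ring_scope.

(** * Task counts, and the first time a total of transformed counts reaches [m] *)

Section Crossing.
Variables (R : realType) (tau : R).
Hypothesis tau_gt0 : 0 < tau.

(** Counts truncated at 0 satisfy the left side at every [t] when [k = 0], hence the restriction to
    positive [k]. *)
Lemma completed_geE (k : nat) (x t : R) : (0 < k)%N ->
  (k%:Z <= completed tau x t) = (x + k%:R * tau <= t).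
Proof.
move=> k0; rewrite /completed le_max lez_nat leqNgt k0 /=.
by rewrite floor_ge_int ler_pdivlMr// lerBrDl.
Qed.

Lemma le_completed (x s t : R) : s <= t ->
  completed tau x s <= completed tau x t.
Proof.
move=> st; rewrite /completed ge_max !le_max lexx le_floor ?orbT//.
rewrite ler_pM2r ?invr_gt0//.
exact: lerB.
Qed.

Lemma completed_le (x y t : R) : x <= y ->
  completed tau y t <= completed tau x t.
Proof.
move=> xy; rewrite /completed ge_max !le_max lexx le_floor ?orbT//.
rewrite ler_pM2r ?invr_gt0//.
exact: lerB.
Qed.

Lemma completed_eq0 (x t : R) : t < x + tau -> completed tau x t = 0.
Proof.
move=> tx; have : 0 <= completed tau x t by rewrite /completed le_max lexx.
have : ~~ (1%:Z <= completed tau x t) by rewrite completed_geE// mul1r -ltNge.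
lia.
Qed.

(** Right-continuity in the form used below: [t] lies strictly before the end of the next task, and
    so do all times near [t]. *)
Lemma near_completed_le (x t : R) :
  \forall s \near t, completed tau x s <= completed tau x t.
Proof.
have [n Ht] : exists n : nat, completed tau x t = n%:Z.
  have : 0 <= completed tau x t by rewrite /completed le_max lexx.
  by case: (completed tau x t) => // n _; exists n.
have : t < x + n.+1%:R * tau.
  by rewrite ltNge -completed_geE// Ht lez_nat ltnn.
move=> /(lt_nbhsl)/=; apply: filterS => s.
by rewrite ltNge -completed_geE// -ltNge Ht; lia.
Qed.

Variables (p m : nat) (g : int -> R).
Hypotheses (g_homo : {homo g : j k / j <= k}) (g0 : g 0 = 0).
Hypotheses (m_gt0 : (0 < m)%N) (g_big : exists k, m%:R <= p%:R * g k).

(** Common form of both latencies: [g] is the cast to the reals for ideal balancing, and truncation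
    at a worker's capacity for LT. *)
Definition crossing (x : 'I_p -> R) : set R :=
  [set t | m%:R <= \sum_(i < p) g (completed tau (x i) t)].

Lemma crossing_minE (x : 'I_p -> R) :
  is_min (crossing x) (minimum (crossing x)).
Proof.
suff [t mint] : exists t, is_min (crossing x) t.
  exact: (@xgetPex _ 0 [set t | is_min (crossing x) t] (ex_intro _ t mint)).
have lbA : has_lbound (crossing x).
  (* The default 0 can only lower the minimum of the delays; before this bound no worker has
     finished a task. *)
  exists (\big[Order.min/0]_(i < p) x i) => t; rewrite /crossing/= => At.
  rewrite leNgt; apply/negP => tlt; move: At; rewrite leNgt => /negP; apply.
  rewrite big1 ?ltr0n// => i _; rewrite completed_eq0 ?g0//.
  apply: (lt_le_trans tlt); apply: (@le_trans _ _ (x i)).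
    exact: bigmin_le_cond.
  by rewrite lerDl ltW.
have neA : crossing x !=set0.
  have [k Hk] := g_big.
  (* [K] is positive and at least [k]; the witness is a time by which every worker has finished [K]
     tasks. *)
  pose K : nat := `|k|.+1.
  exists (\big[Order.max/0]_(i < p) (x i + K%:R * tau)).
  rewrite /crossing/=; apply: (le_trans Hk).
  rewrite -[p in p%:R]card_ord mulr_natl -sumr_const; apply: ler_sum => i _.
  apply: g_homo; apply: (@le_trans _ _ K%:Z); first by rewrite /K; lia.
  rewrite completed_geE//.
  exact: le_bigmax_cond.
exists (inf (crossing x)); split; last exact: ge_inf.
rewrite /crossing/= leNgt; apply/negP => ltm.
(* Near the infimum no count exceeds its value there, so a member of the set close to the infimum
   forces the infimum into the set. *)
have : \forall s \near inf (crossing x), forall i : 'I_p,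
    completed tau (x i) s <= completed tau (x i) (inf (crossing x)).
  exact: filter_forall (fun i => near_completed_le (x i) _).
move=> /nbhs_ballP[e /= e0 He].
have [s As slt] := inf_adherent e0 (conj neA lbA).
have : ball (inf (crossing x)) e s.
  rewrite /ball/= distrC ger0_norm ?subr_ge0 ?ge_inf//.
  by rewrite ltrBlDl.
move=> /He Hs; move: As; rewrite /crossing/= leNgt => /negP; apply.
apply: le_lt_trans ltm; apply: ler_sum => i _; exact: g_homo.
Qed.

Lemma minimum_leE (x : 'I_p -> R) (t : R) :
  (minimum (crossing x) <= t) =
  (m%:R <= \sum_(i < p) g (completed tau (x i) t)).
Proof.
have [Amin lbmin] := crossing_minE x.
apply/idP/idP => [le_t|/lbmin//].
apply: (le_trans Amin); apply: ler_sum => i _; exact/g_homo/le_completed.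
Qed.

(** The minimum exceeds [t] exactly when the total at [t] is below [m], and each summand is a
    monotone, hence measurable, function of the delay. *)
Lemma measurable_minimum (d : measure_display) (T : measurableType d)
    (X : 'I_p -> T -> R) (mX : forall i, measurable_fun setT (X i)) :
  measurable_fun setT (fun w => minimum (crossing (X ^~ w))).
Proof.
apply: (measurability _ (RGenOInfty.measurableE R)) => //.
move=> /= _ [_ [t ->] <-].
rewrite [X in measurable X](_ : _ = setT `&`
  [set w | \sum_(i < p) g (completed tau (X i w) t) < m%:R]); last first.
  by apply/seteqP; split => w /=; rewrite in_itv/= andbT !ltNge minimum_leE.
have ms : measurable_fun setT
    (fun w => \sum_(i < p) g (completed tau (X i w) t)).
  apply: measurable_sum => i.
  apply: (measurableT_comp (f := fun y => g (completed tau y t))) => //.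
  apply: nonincreasing_measurable => // y z yz; exact/g_homo/completed_le.
have mlt := measurable_fun_ltr ms (measurable_cst (m%:R : R)).
exact: mlt measurableT [set true] I.
Qed.

End Crossing.

(** * The two latencies and their deterministic comparison *)

Section Latencies.
Variables (R : realType) (tau : R) (p m c : nat).
Hypotheses (tau_gt0 : 0 < tau) (m_gt0 : (0 < m)%N) (le_m_pc : (m <= p * c)%N).

Let cap (k : int) : R := Num.min c%:R k%:~R.

Let cap_homo : {homo cap : j k / j <= k}.
Proof. by move=> j k jk; rewrite /cap le_min !ge_min lexx ler_int jk orbT. Qed.

Let cap0 : cap 0 = 0.
Proof. by rewrite /cap min_r ?ler0n. Qed.

(** With all workers at full capacity the total [p * c] reaches [m], so decoding is possible. *)
Let cap_big : exists k, m%:R <= p%:R * cap k.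
Proof. by exists c%:Z; rewrite /cap minxx -natrM ler_nat. Qed.

Let intr_homo : {homo (intr : int -> R) : j k / j <= k}.
Proof. by move=> j k; rewrite ler_int. Qed.

Let intr_big : exists k : int, m%:R <= p%:R * k%:~R :> R.
Proof. by exists c%:Z; rewrite -natrM ler_nat. Qed.

Lemma T_idealE (x : 'I_p -> R) :
  T_ideal m tau x = minimum (crossing tau m intr x).
Proof.
congr minimum; apply/seteqP; split => t;
  by rewrite /crossing/= -raddf_sum/= -[_ <= _ :> int](ler_int R).
Qed.

Lemma T_ideal_leE (x : 'I_p -> R) (t : R) :
  (T_ideal m tau x <= t) = (m%:Z <= \sum_(i < p) completed tau (x i) t).
Proof.
rewrite T_idealE minimum_leE// -raddf_sum/=.
by rewrite -[RHS](ler_int R).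
Qed.

Variables (alpha : R).
Hypothesis cE : alpha * m%:R / p%:R = c%:R.

Lemma T_LTE (x : 'I_p -> R) :
  T_LT m alpha tau x = minimum (crossing tau m cap x).
Proof. by rewrite /T_LT cE. Qed.

Lemma T_LT_leE (x : 'I_p -> R) (t : R) :
  (T_LT m alpha tau x <= t) =
  (m%:R <= \sum_(i < p) Num.min (c%:R : R) (completed tau (x i) t)%:~R).
Proof. by rewrite T_LTE minimum_leE. Qed.

Lemma measurable_T_ideal (d : measure_display) (T : measurableType d)
    (X : 'I_p -> T -> R) (mX : forall i, measurable_fun setT (X i)) :
  measurable_fun setT (fun w => T_ideal m tau (X ^~ w)).
Proof.
by under eq_fun do rewrite T_idealE; exact: measurable_minimum.
Qed.

Lemma measurable_T_LT (d : measure_display) (T : measurableType d)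
    (X : 'I_p -> T -> R) (mX : forall i, measurable_fun setT (X i)) :
  measurable_fun setT (fun w => T_LT m alpha tau (X ^~ w)).
Proof.
by under eq_fun do rewrite T_LTE; exact: measurable_minimum.
Qed.

Lemma T_ideal_lt_T_LT (b : nat) (x : 'I_p -> R) : (m <= p * b)%N ->
  T_ideal m tau x < T_LT m alpha tau x ->
  exists i j, x i + c.+1%:R * tau <= x j + b%:R * tau.
Proof.
move=> le_m_pb; set t := T_ideal m tau x => t_lt.
have b_gt0 : (0 < b)%N by case: b le_m_pb => //; rewrite muln0 leqNgt m_gt0.
have [i ti] : exists i, x i + c.+1%:R * tau <= t.
  apply: contrapT => /forallNP ti; move: t_lt.
  rewrite ltNge T_LT_leE => /negP; apply.
  (* No worker has reached [c.+1] tasks by [t], so no cap is active and LT also has [m] products at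
     [t]. *)
  have -> : \sum_(i < p) Num.min c%:R (completed tau (x i) t)%:~R =
            \sum_(i < p) (completed tau (x i) t)%:~R :> R.
    apply: eq_bigr => i _; apply: min_r; rewrite -[c%:R]/(c%:Z%:~R) ler_int.
    by move/negP: (ti i); rewrite -completed_geE//; lia.
  by rewrite -raddf_sum/= -[m%:R]/(m%:Z%:~R) ler_int -T_ideal_leE.
exists i; apply: contrapT => /forallNP tj.
(* The default is itself one of the terms, so [s < t] follows from the bounds on the terms alone. By
   time [s] every worker could have finished [b] tasks. *)
pose s := \big[Order.max/x i + b%:R * tau]_(j < p) (x j + b%:R * tau).
have : s < t.
  have tj' j : x j + b%:R * tau < t.
    by apply: lt_le_trans ti; rewrite ltNge; apply/negP.
  by apply: bigmax_lt => // j _; exact: tj'.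
apply/negP; rewrite -leNgt T_ideal_leE.
apply: (@le_trans _ _ (\sum_(j < p) b%:Z)).
  by rewrite sumr_const card_ord; lia.
apply: ler_sum => j _; rewrite completed_geE//; exact: le_bigmax.
Qed.

End Latencies.

(** * Exponential tail and union bound *)

(** The complement of [[0, u]] also contains the negative reals, but they carry no mass, so only the
    tail beyond [u] counts. *)
Lemma exponential_notin_itv (d : measure_display) (T : measurableType d)
    (R : realType) (P : probability T R) (rate u : R) (X : {RV P >-> R}) :
  0 < u -> exponentially_distributed rate X ->
  P (~` (X @^-1` `[0, u])) = (expR (- (rate * u)))%:E.
Proof.
move=> u0 expX; have mA : measurable (X @^-1` `[0, u]).
  by rewrite -[X in measurable X]setTI; exact: measurable_funP.
rewrite probability_setC//.
have -> : P (X @^-1` `[0, u]) = (1 - expR (- (rate * u)))%:E.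
  rewrite -[LHS]/(distribution P X `[0, u]) expX//.
  by rewrite exponential_prob_itv0c// mulNr.
by rewrite -EFinB opprB addrCA subrr addr0.
Qed.

Lemma le_measure_bigcup_ord (d : measure_display) (T : measurableType d)
    (R : realType) (P : {measure set T -> \bar R}) (p : nat)
    (A : set T) (B : 'I_p -> set T) :
  measurable A -> (forall i, measurable (B i)) ->
  (A `<=` \bigcup_i B i -> P A <= \sum_(i < p) P (B i))%E.
Proof.
case: p B => [|p] B mA mB AB.
  rewrite big_ord0 (_ : A = set0) ?measure0//.
  by apply/seteqP; split => // w /AB[[]].
(* Subadditivity is applied to a family indexed by naturals; [inord] extends [B] to one, which
   requires a nonempty index type. *)
rewrite (eq_bigr (fun i : 'I_p.+1 => P (B (inord i)))); last first.
  by move=> i _; rewrite inord_val.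
apply: (content_subadditive P (F := fun k => B (inord k))) => //.
move=> w /AB[i _ Bi]; rewrite -(bigcup_mkord p.+1 (fun k => B (inord k))).
by exists i => /=; rewrite ?inord_val.
Qed.

Theorem corollary2 (d : measure_display) (Omega : measurableType d)
    (R : realType) (P : probability Omega R) (p m : nat) (tau mu alpha : R)
    (X : 'I_p -> {RV P >-> R})
    (hp : (2 <= p)%N) (hm : (1 <= m)%N) (htau : 0 < tau) (hmu : 0 < mu)
    (halpha : 1 < alpha) (hint : alpha * m%:R / p%:R \is a Num.int)
    (hindep : mutually_independent X)
    (hexp : forall i, exponentially_distributed mu (X i)) :
  (P [set w | (T_LT m alpha tau (fun i => X i w) >
               T_ideal m tau (fun i => X i w))%R] <=
   (p%:R * expR (- (mu * tau * m%:R * (alpha - 1) / p%:R ^+ 2)))%:E)%E.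
Proof.
have p0 : 0 < p%:R :> R by rewrite ltr0n (leq_trans _ hp).
have m0 : 0 < m%:R :> R by rewrite ltr0n.
have [c cE] : exists c : nat, alpha * m%:R / p%:R = c%:R.
  apply/natrP; rewrite natrEint hint/= divr_ge0// ltW// mulr_gt0//.
  exact: lt_trans halpha.
have amE : alpha * m%:R = p%:R * c%:R by rewrite -cE [RHS]mulrC divfK// gt_eqF.
have le_m_pc : (m <= p * c)%N.
  by rewrite -(ler_nat R) natrM -amE ler_peMl// ltW.
pose u := tau * (m%:R * (alpha - 1)) / p%:R ^+ 2.
have am0 : 0 < m%:R * (alpha - 1) by rewrite mulr_gt0// subr_gt0.
have u0 : 0 < u by rewrite divr_gt0 ?exprn_gt0// mulr_gt0.
have -> : mu * tau * m%:R * (alpha - 1) / p%:R ^+ 2 = mu * u.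
  by rewrite /u !mulrA.
have mX i : measurable_fun setT (X i) by exact: measurable_funP.
have mE : measurable [set w | T_LT m alpha tau (fun i => X i w) >
                              T_ideal m tau (fun i => X i w)].
  rewrite -[X in measurable X]setTI.
  have mlt := measurable_fun_ltr (measurable_T_ideal htau hm le_m_pc mX)
    (measurable_T_LT htau hm le_m_pc cE mX).
  exact: mlt measurableT [set true] I.
have -> : (p%:R * expR (- (mu * u)))%:E =
          (\sum_(i < p) P (~` (X i @^-1` `[0%R, u])))%E.
  under eq_bigr do rewrite (exponential_notin_itv u0 (hexp _)).
  by rewrite sumEFin sumr_const card_ord mulr_natl.
apply: le_measure_bigcup_ord => // [i|w /= Ew].
  by apply: measurableC; rewrite -[X in measurable X]setTI; exact: mX.
(* b is the ceiling of m / p *)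
pose b := ((m + p.-1) %/ p)%N.
have le_m_pb : (m <= p * b)%N.
  have := divn_eq (m + p.-1) p.
  have : ((m + p.-1) %% p < p)%N by rewrite ltn_mod; lia.
  by rewrite /b; lia.
have le_pb : (p * b <= m + p.-1)%N by rewrite /b mulnC leq_trunc_div.
have [i [j Xij]] := T_ideal_lt_T_LT htau hm le_m_pc cE le_m_pb Ew.
apply: contrapT => /forall2NP noB.
have X0u k : 0 <= X k w <= u.
  by case: (noB k) => [/(_ I)[]|/contrapT]; rewrite /= in_itv.
(* From [p * b < m + p] and [p * c = alpha * m] one gets [p * (c + 1 - b) > m * (alpha - 1)];
   replacing [p] by [p ^ 2] in the denominator only loses. *)
have lt_u : u < (c.+1%:R - b%:R) * tau.
  rewrite /u -mulrA mulrC ltr_pM2r//.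
  apply: (@le_lt_trans _ _ (m%:R * (alpha - 1) / p%:R)).
    rewrite ler_pM2l// lef_pV2 ?posrE ?exprn_gt0// ler_eXnr// ler1n.
    exact: leq_trans hp.
  rewrite ltr_pdivrMr// mulrBr mulr1 [m%:R * _]mulrC amE mulrC.
  have : p%:R * b%:R < m%:R + p%:R :> R by rewrite -natrM -natrD ltr_nat; lia.
  rewrite -natr1; nra.
(* Two delays in [[0, u]] differ by at most [u], against the gap in [Xij]. *)
have := X0u i; have := X0u j; lra.
Qed.
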